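(* Let $\mathsf{C}$ be a partializable Markov category. Then the quasi-Markov category $\mathsf{Partial}(\mathsf{C})$ is positive.
   Context: A CD category is a symmetric monoidal category $(\mathsf{C},\otimes,I)$ in which every object $X$ carries a commutative comonoid structure $\mathrm{copy}_X\colon X\to X\otimes X$, $\mathrm{del}_X\colon X\to I$, compatible with tensor products ($\mathrm{copy}_{X\otimes Y}$ is $\mathrm{copy}_X\otimes\mathrm{copy}_Y$ followed by swapping the two middle factors, and $\mathrm{del}_{X\otimes Y}=\mathrm{del}_X\otimes\mathrm{del}_Y$) and with $\mathrm{copy}_I=\mathrm{del}_I=\mathrm{id}_I$; coherence isomorphisms are suppressed. A morphism $f\colon X\to Y$ is total if $\mathrm{del}_Y\circ f=\mathrm{del}_X$, copyable if $\mathrm{copy}_Y\circ f=(f\otimes f)\circ\mathrm{copy}_X$, deterministic if it is both, and quasi-total if $(f\otimes(\mathrm{del}_Y\circ f))\circ\mathrm{copy}_X=f$. A Markov category is a CD category in which every morphism is total; a quasi-Markov category is a CD category in which every morphism is quasi-total (every Markov category is quasi-Markov). A quasi-Markov category is positive if for all $u\colon X\to Y$, $v\colon Y\to Z$ with $v\circ u$ copyable, $(u\otimes (v\circ u))\circ\mathrm{copy}_X=(\mathrm{id}_Y\otimes v)\circ\mathrm{copy}_Y\circ u$. A Markov category $\mathsf{C}$ is partializable if: (i) it is positive; (ii) pullbacks of deterministic monomorphisms along arbitrary morphisms exist and are themselves deterministic (monomorphisms); (iii) if $i\colon D\to X$ is a deterministic monomorphism then $i\otimes\mathrm{id}_A$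 is a monomorphism for every object $A$. For $\mathsf{C}$ partializable, the CD category $\mathsf{Partial}(\mathsf{C})$ (which is quasi-Markov) has the objects of $\mathsf{C}$; its morphisms $X\to Y$ are equivalence classes of spans $X\xleftarrow{i}D\xrightarrow{f}Y$ (also written $(D,i,f)$) in $\mathsf{C}$ with $i$ a deterministic monomorphism, where $(D,i,f)\sim(D',i',f')$ iff there is an isomorphism $t\colon D\to D'$ with $i'\circ t=i$, $f'\circ t=f$. The composite of $(A,i,f)\colon X\to Y$ followed by $(B,j,g)\colon Y\to Z$ is $(C,i\circ u,g\circ v)$, where $A\xleftarrow{u}C\xrightarrow{v}B$ is the pullback of $f$ and $j$. The inclusion $\mathsf{C}\hookrightarrow\mathsf{Partial}(\mathsf{C})$ sends $f\colon X\to Y$ to $(X,\mathrm{id}_X,f)$. The tensor product is componentwise, $(A,i,f)\otimes(B,j,g)=(A\otimes B,i\otimes j,f\otimes g)$, and the copy and delete maps (and coherence isomorphisms) are the images of those of $\mathsf{C}$ under the inclusion. *)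

(* Defs.v *)
From HB Require Import structures.
From mathcomp Require Import all_boot generic_quotient boolp.

Set Implicit Arguments.
Unset Strict Implicit.
Unset Printing Implicit Defensive.

Declare Scope cat_scope.
Delimit Scope cat_scope with cat.
Local Open Scope cat_scope.

Reserved Notation "g ∘ f" (at level 40, left associativity).
Reserved Notation "X ⊗ Y" (at level 30, right associativity).
Reserved Notation "f ⊗ₘ g" (at level 30, right associativity).

Record category := Category {
  ob :> Type;
  hom : ob -> ob -> Type;
  idm : forall X, hom X X;
  comp : forall X Y Z, hom Y Z -> hom X Y -> hom X Z;
  comp_idl : forall X Y (f : hom X Y), comp (idm Y) f = f;
  comp_idr : forall X Y (f : hom X Y), comp f (idm X) = f;
  compA : forall X Y Z W (h : hom Z W) (g : hom Y Z) (f : hom X Y),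
    comp h (comp g f) = comp (comp h g) f }.

Arguments hom {c} X Y.
Arguments idm {c} X.
Arguments comp {c X Y Z} g f.
Notation "g ∘ f" := (comp g f) : cat_scope.

Definition monic (C : category) (X Y : C) (i : hom X Y) : Prop :=
  forall (W : C) (a b : hom W X), i ∘ a = i ∘ b -> a = b.

Definition is_iso (C : category) (X Y : C) (t : hom X Y) : Prop :=
  exists s : hom Y X, s ∘ t = idm X /\ t ∘ s = idm Y.

Definition is_pullback (C : category) (X Y Z P : C)
    (f : hom X Z) (g : hom Y Z) (p : hom P X) (q : hom P Y) : Prop :=
  f ∘ p = g ∘ q /\
  forall (W : C) (a : hom W X) (b : hom W Y), f ∘ a = g ∘ b ->
    exists! w : hom W P, p ∘ w = a /\ q ∘ w = b.

(* Monoidal categories are not assumed strict: [assoc], [lunit], [runit] and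
   their inverses [assoc'], [lunit'], [runit'] are part of the structure. *)
Record sym_mon_category := SymMonCategory {
  smc_cat :> category;
  tens : smc_cat -> smc_cat -> smc_cat;
  unit_ob : smc_cat;
  tensm : forall X Y X' Y' : smc_cat,
    hom X Y -> hom X' Y' -> hom (tens X X') (tens Y Y');
  assoc : forall X Y Z, hom (tens (tens X Y) Z) (tens X (tens Y Z));
  assoc' : forall X Y Z, hom (tens X (tens Y Z)) (tens (tens X Y) Z);
  lunit : forall X, hom (tens unit_ob X) X;
  lunit' : forall X, hom X (tens unit_ob X);
  runit : forall X, hom (tens X unit_ob) X;
  runit' : forall X, hom X (tens X unit_ob);
  swap : forall X Y, hom (tens X Y) (tens Y X);
  tensm_id : forall X Y, tensm (idm X) (idm Y) = idm (tens X Y);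
  tensm_comp : forall (X Y Z X' Y' Z' : smc_cat)
      (g : hom Y Z) (f : hom X Y) (g' : hom Y' Z') (f' : hom X' Y'),
    tensm (g ∘ f) (g' ∘ f') = tensm g g' ∘ tensm f f';
  assocK : forall X Y Z, assoc' X Y Z ∘ assoc X Y Z = idm _;
  assocK' : forall X Y Z, assoc X Y Z ∘ assoc' X Y Z = idm _;
  lunitK : forall X, lunit' X ∘ lunit X = idm _;
  lunitK' : forall X, lunit X ∘ lunit' X = idm _;
  runitK : forall X, runit' X ∘ runit X = idm _;
  runitK' : forall X, runit X ∘ runit' X = idm _;
  swapK : forall X Y, swap Y X ∘ swap X Y = idm _;
  assoc_nat : forall (X Y Z X' Y' Z' : smc_cat)
      (f : hom X X') (g : hom Y Y') (h : hom Z Z'),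
    assoc X' Y' Z' ∘ tensm (tensm f g) h = tensm f (tensm g h) ∘ assoc X Y Z;
  lunit_nat : forall (X Y : smc_cat) (f : hom X Y),
    lunit Y ∘ tensm (idm unit_ob) f = f ∘ lunit X;
  runit_nat : forall (X Y : smc_cat) (f : hom X Y),
    runit Y ∘ tensm f (idm unit_ob) = f ∘ runit X;
  swap_nat : forall (X Y X' Y' : smc_cat) (f : hom X X') (g : hom Y Y'),
    swap X' Y' ∘ tensm f g = tensm g f ∘ swap X Y;
  pentagon : forall X Y Z W,
    assoc X Y (tens Z W) ∘ assoc (tens X Y) Z W =
    tensm (idm X) (assoc Y Z W) ∘ assoc X (tens Y Z) W
      ∘ tensm (assoc X Y Z) (idm W);
  triangle : forall X Y,
    tensm (idm X) (lunit Y) ∘ assoc X unit_ob Y = tensm (runit X) (idm Y);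
  hexagon : forall X Y Z,
    assoc Y Z X ∘ swap X (tens Y Z) ∘ assoc X Y Z =
    tensm (idm Y) (swap X Z) ∘ assoc Y X Z ∘ tensm (swap X Y) (idm Z) }.

Arguments tens {s} X Y.
Arguments unit_ob {s}.
Arguments tensm {s X Y X' Y'} f g.
Arguments assoc {s} X Y Z.
Arguments assoc' {s} X Y Z.
Arguments lunit {s} X.
Arguments lunit' {s} X.
Arguments runit {s} X.
Arguments runit' {s} X.
Arguments swap {s} X Y.
Notation "X ⊗ Y" := (tens X Y) : cat_scope.
Notation "f ⊗ₘ g" := (tensm f g) : cat_scope.

(* (W X)(Y Z) -> (W Y)(X Z) *)
Definition middle_swap (C : sym_mon_category) (W X Y Z : C) :
    hom ((W ⊗ X) ⊗ (Y ⊗ Z)) ((W ⊗ Y) ⊗ (X ⊗ Z)) :=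
  assoc' W Y (X ⊗ Z)
    ∘ (idm W ⊗ₘ (assoc Y X Z ∘ (swap X Y ⊗ₘ idm Z) ∘ assoc' X Y Z))
    ∘ assoc W X (Y ⊗ Z).
Arguments middle_swap {C} W X Y Z.

Record cd_category := CDCategory {
  cd_smc :> sym_mon_category;
  copy : forall X : cd_smc, hom X (X ⊗ X);
  del : forall X : cd_smc, hom X unit_ob;
  copyA : forall X,
    assoc X X X ∘ (copy X ⊗ₘ idm X) ∘ copy X = (idm X ⊗ₘ copy X) ∘ copy X;
  copyC : forall X, swap X X ∘ copy X = copy X;
  copy_dell : forall X, lunit X ∘ (del X ⊗ₘ idm X) ∘ copy X = idm X;
  copy_delr : forall X, runit X ∘ (idm X ⊗ₘ del X) ∘ copy X = idm X;
  copy_tens : forall X Y,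
    copy (X ⊗ Y) = middle_swap X X Y Y ∘ (copy X ⊗ₘ copy Y);
  del_tens : forall X Y, del (X ⊗ Y) = lunit unit_ob ∘ (del X ⊗ₘ del Y);
  copy_unit : copy unit_ob = lunit' unit_ob;
  del_unit : del unit_ob = idm unit_ob }.

Arguments copy {c} X.
Arguments del {c} X.

Section CDMorphisms.
Variables (C : cd_category) (X Y : C) (f : hom X Y).

Definition total : Prop := del Y ∘ f = del X.
Definition copyable : Prop := copy Y ∘ f = (f ⊗ₘ f) ∘ copy X.
Definition deterministic : Prop := total /\ copyable.
Definition quasi_total : Prop := runit Y ∘ (f ⊗ₘ (del Y ∘ f)) ∘ copy X = f.
Definition det_mono : Prop := deterministic /\ monic f.

End CDMorphisms.

Record markov_category := MarkovCategory {
  markov_cd :> cd_category;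
  markov_total : forall (X Y : markov_cd) (f : hom X Y), total f }.

Record quasi_markov_category := QuasiMarkovCategory {
  qmarkov_cd :> cd_category;
  qmarkov_quasi_total : forall (X Y : qmarkov_cd) (f : hom X Y),
    quasi_total f }.

Definition positive (C : quasi_markov_category) : Prop :=
  forall (X Y Z : C) (u : hom X Y) (v : hom Y Z), copyable (v ∘ u) ->
    (u ⊗ₘ (v ∘ u)) ∘ copy X = (idm Y ⊗ₘ v) ∘ copy Y ∘ u.

Lemma total_quasi_total (C : cd_category) (X Y : C) (f : hom X Y) :
  total f -> quasi_total f.
Proof.
move=> tf; rewrite /quasi_total tf -{1}[f]comp_idr -{1}[del X]comp_idl.
by rewrite tensm_comp !compA runit_nat -!compA (compA (runit X)) copy_delr
  comp_idr.
Qed.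

Definition quasi_markov_of_markov (C : markov_category) :
    quasi_markov_category :=
  QuasiMarkovCategory (fun X Y f => total_quasi_total (@markov_total C X Y f)).
Coercion quasi_markov_of_markov : markov_category >-> quasi_markov_category.

(* The second component of [partializable_pullback] concerns every pullback of i:
   isomorphisms in a Markov category need not be deterministic a priori. *)
Record partializable (C : markov_category) : Prop := Partializable {
  partializable_positive : positive C;
  partializable_pullback : forall (D X A : C) (i : hom D X) (f : hom A X),
    det_mono i ->
    (exists (P : C) (p : hom P A) (q : hom P D), is_pullback f i p q) /\
    (forall (P : C) (p : hom P A) (q : hom P D),
      is_pullback f i p q -> det_mono p);
  partializable_tens : forall (D X A : C) (i : hom D X),
    det_mono i -> monic (i ⊗ₘ idm A) }.


Section CategoryFacts.
Variable C : category.

Lemma iso_pullback (X X' Y Y' : C) (phi : hom X X') (psi : hom Y Y')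
    (i : hom Y X) (i' : hom Y' X') :
  is_iso phi -> is_iso psi -> phi ∘ i = i' ∘ psi -> is_pullback phi i' i psi.
Proof.
move=> [phi' [phiK phiK']] [psi' [psiK psiK']] e; split=> // W a b eab.
have e' : i ∘ psi' = phi' ∘ i'.
  by rewrite -[LHS]comp_idl -phiK -compA (compA phi) e -compA psiK' comp_idr.
exists (psi' ∘ b); split.
  by rewrite !compA e' psiK' comp_idl -compA -eab compA phiK comp_idl.
by move=> w [_ <-]; rewrite compA psiK comp_idl.
Qed.

Lemma id_pullbackl (X Y : C) (i : hom Y X) : is_pullback (idm X) i i (idm Y).
Proof.
by apply: iso_pullback; rewrite ?comp_idl ?comp_idr //; eexists; split;
  exact: comp_idl.
Qed.

Lemma id_pullbackr (X Y : C) (f : hom X Y) : is_pullback f (idm Y) (idm X) f.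
Proof.
split=> [|W a b e]; first by rewrite comp_idl comp_idr.
exists a; split; first by rewrite comp_idl e comp_idl.
by move=> w [<-]; rewrite comp_idl.
Qed.

Lemma pullback_unique (X Y Z P Q : C) (f : hom X Z) (g : hom Y Z)
    (p : hom P X) (q : hom P Y) (p' : hom Q X) (q' : hom Q Y) :
  is_pullback f g p q -> is_pullback f g p' q' ->
  exists t : hom P Q, is_iso t /\ p' ∘ t = p /\ q' ∘ t = q.
Proof.
move=> [e U] [e' U'].
have [t [[tp tq] _]] := U' _ _ _ e.
have [s [[sp sq] _]] := U _ _ _ e'.
exists t; split=> //; exists s; split.
  have [w [_ Uw]] := U _ _ _ e.
  by rewrite -(Uw (s ∘ t)) ?(Uw (idm P)) // ?comp_idr // !compA sp sq.
have [w [_ Uw]] := U' _ _ _ e'.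
by rewrite -(Uw (t ∘ s)) ?(Uw (idm Q)) // ?comp_idr // !compA tp tq.
Qed.

Lemma monic_comp (X Y Z : C) (j : hom Y Z) (i : hom X Y) :
  monic j -> monic i -> monic (j ∘ i).
Proof. by move=> mj mi W a b; rewrite -!compA => /mj /mi. Qed.

Lemma monic_idm (X : C) : monic (idm X).
Proof. by move=> W a b; rewrite !comp_idl. Qed.

Lemma iso_monic (X Y : C) (t : hom X Y) : is_iso t -> monic t.
Proof.
move=> [s [st _]] W a b e.
by rewrite -[a]comp_idl -[b]comp_idl -st -!compA e.
Qed.

(* For monic g, uniqueness and the second projection come for free. *)
Lemma mono_pullback (X Y Z P : C) (f : hom X Z) (g : hom Y Z)
    (p : hom P X) (q : hom P Y) :
  monic g -> monic p -> f ∘ p = g ∘ q ->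
  (forall (W : C) (a : hom W X) (b : hom W Y), f ∘ a = g ∘ b ->
    exists w : hom W P, p ∘ w = a) ->
  is_pullback f g p q.
Proof.
move=> mg mp e U; split=> // W a b eab.
have [w pw] := U _ _ _ eab; exists w; split; last first.
  by move=> w' [pw' _]; apply: mp; rewrite pw.
by split=> //; apply: mg; rewrite compA -e -compA pw.
Qed.

Lemma pullback_monic (X Y Z P : C) (f : hom X Z) (g : hom Y Z)
    (p : hom P X) (q : hom P Y) : monic g -> is_pullback f g p q -> monic p.
Proof.
move=> mg [e U] W a b pab.
have eab : f ∘ (p ∘ a) = g ∘ (q ∘ a) by rewrite !compA e.
have [w [_ Uw]] := U _ _ _ eab.
rewrite -(Uw a) ?(Uw b) //; split=> //.
by apply: mg; rewrite !compA -e -!compA pab.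
Qed.

(* Here P = A x_Y B, Q = B x_Z E and S = P x_B Q; then S is both A x_Y Q
   and P x_Z E. *)
Lemma pullback_paste (A B E Y Z P Q S : C) (f : hom A Y) (j : hom B Y)
    (g : hom B Z) (k : hom E Z) (p1 : hom P A) (p2 : hom P B)
    (q1 : hom Q B) (q2 : hom Q E) (s1 : hom S P) (s2 : hom S Q) :
  is_pullback f j p1 p2 -> is_pullback g k q1 q2 -> is_pullback p2 q1 s1 s2 ->
  is_pullback f (j ∘ q1) (p1 ∘ s1) s2 /\ is_pullback (g ∘ p2) k s1 (q2 ∘ s2).
Proof.
move=> [eP UP] [eQ UQ] [eS US]; split; split.
- by rewrite compA eP -!compA eS.
- move=> W a b; rewrite -compA => /[dup] eab /UP [x [[x1 x2] Ux]].
  have [w [[w1 w2] Uw]] := US _ _ _ x2.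
  exists w; split; first by rewrite -compA w1 x1 w2.
  move=> w' [w'1 w'2]; apply: Uw; split=> //; apply/esym/Ux.
  by rewrite compA w'1 compA eS -compA w'2.
- by rewrite -compA eS compA eQ compA.
- move=> W a b; rewrite -compA => /[dup] eab /UQ [y [[y1 y2] Uy]].
  have [w [[w1 w2] Uw]] := US _ _ _ (esym y1).
  exists w; split; first by rewrite -compA w2 y2.
  move=> w' [w'1 w'2]; apply: Uw; split=> //; apply/esym/Uy.
  by rewrite !compA -eS -compA w'1 w'2.
Qed.

End CategoryFacts.

Section MonoidalFacts.
Variable C : sym_mon_category.

Lemma is_iso_assoc (X Y Z : C) : is_iso (assoc X Y Z).
Proof. by exists (assoc' X Y Z); rewrite assocK assocK'. Qed.

Lemma is_iso_lunit (X : C) : is_iso (lunit X).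
Proof. by exists (lunit' X); rewrite lunitK lunitK'. Qed.

Lemma is_iso_runit (X : C) : is_iso (runit X).
Proof. by exists (runit' X); rewrite runitK runitK'. Qed.

Lemma is_iso_swap (X Y : C) : is_iso (swap X Y).
Proof. by exists (swap Y X); rewrite !swapK. Qed.

Lemma tensmE (X Y X' Y' : C) (f : hom X Y) (g : hom X' Y') :
  f ⊗ₘ g = (f ⊗ₘ idm Y') ∘ (idm X ⊗ₘ g).
Proof. by rewrite -tensm_comp comp_idl comp_idr. Qed.

Lemma assoc'_nat (X Y Z X' Y' Z' : C)
    (f : hom X X') (g : hom Y Y') (h : hom Z Z') :
  assoc' X' Y' Z' ∘ (f ⊗ₘ (g ⊗ₘ h)) = ((f ⊗ₘ g) ⊗ₘ h) ∘ assoc' X Y Z.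
Proof.
rewrite -[LHS]comp_idr -(assocK' X Y Z) compA -(compA (assoc' _ _ _)).
by rewrite -assoc_nat !compA assocK comp_idl.
Qed.

Lemma middle_swap_nat (A B D E A' B' D' E' : C) (f : hom A A') (g : hom B B')
    (h : hom D D') (k : hom E E') :
  middle_swap A' B' D' E' ∘ ((f ⊗ₘ g) ⊗ₘ (h ⊗ₘ k)) =
  ((f ⊗ₘ h) ⊗ₘ (g ⊗ₘ k)) ∘ middle_swap A B D E.
Proof.
rewrite /middle_swap -!compA assoc_nat !compA; congr (_ ∘ _).
rewrite -assoc'_nat -!compA -!tensm_comp comp_idl comp_idr.
congr (_ ∘ (_ ⊗ₘ _)); rewrite -!compA assoc'_nat !compA -assoc_nat -!compA.
congr (_ ∘ _); rewrite !compA -!tensm_comp swap_nat.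
by rewrite comp_idl comp_idr.
Qed.

End MonoidalFacts.

Section CDFacts.
Variable C : cd_category.

Lemma deterministic_idm (X : C) : deterministic (idm X).
Proof.
by split; rewrite /total /copyable ?tensm_id !comp_idr ?comp_idl.
Qed.

Lemma deterministic_comp (X Y Z : C) (g : hom Y Z) (f : hom X Y) :
  deterministic g -> deterministic f -> deterministic (g ∘ f).
Proof.
move=> [tg cg] [tf cf]; split; first by rewrite /total compA tg tf.
by rewrite /copyable compA cg -compA cf compA tensm_comp.
Qed.

Lemma deterministic_tensm (X Y X' Y' : C) (f : hom X Y) (g : hom X' Y') :
  deterministic f -> deterministic g -> deterministic (f ⊗ₘ g).
Proof.
move=> [tf cf] [tg cg]; split.
  by rewrite /total !del_tens -compA -tensm_comp tf tg.
rewrite /copyable !copy_tens -compA -tensm_comp cf cg tensm_comp compA.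
by rewrite middle_swap_nat -compA.
Qed.

Lemma det_mono_idm (X : C) : det_mono (idm X).
Proof. by split; [exact: deterministic_idm | exact: monic_idm]. Qed.

Lemma det_mono_comp (X Y Z : C) (g : hom Y Z) (f : hom X Y) :
  det_mono g -> det_mono f -> det_mono (g ∘ f).
Proof.
move=> [dg mg] [df mf].
by split; [exact: deterministic_comp | exact: monic_comp].
Qed.

End CDFacts.

Section MarkovFacts.
Variable C : markov_category.

Lemma hom_unit_unique (X : C) (f g : hom X unit_ob) : f = g.
Proof.
have e (h : hom X unit_ob) : h = del X.
  by rewrite -(markov_total h) del_unit comp_idl.
by rewrite (e f) (e g).
Qed.

Definition proj1 (X Y : C) : hom (X ⊗ Y) X := runit X ∘ (idm X ⊗ₘ del Y).
Definition proj2 (X Y : C) : hom (X ⊗ Y) Y := lunit Y ∘ (del X ⊗ₘ idm Y).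
Arguments proj1 : clear implicits.
Arguments proj2 : clear implicits.

Lemma proj1_nat (X Y X' Y' : C) (f : hom X X') (g : hom Y Y') :
  proj1 X' Y' ∘ (f ⊗ₘ g) = f ∘ proj1 X Y.
Proof.
rewrite /proj1 -compA -tensm_comp comp_idl (markov_total g) compA -runit_nat.
by rewrite -compA -tensm_comp comp_idl comp_idr.
Qed.

Lemma proj2_nat (X Y X' Y' : C) (f : hom X X') (g : hom Y Y') :
  proj2 X' Y' ∘ (f ⊗ₘ g) = g ∘ proj2 X Y.
Proof.
rewrite /proj2 -compA -tensm_comp comp_idl (markov_total f) compA -lunit_nat.
by rewrite -compA -tensm_comp comp_idl comp_idr.
Qed.

Lemma swap_unit : swap unit_ob unit_ob = idm (unit_ob ⊗ unit_ob) :> @hom C _ _.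
Proof.
apply: (@iso_monic _ _ _ (lunit (unit_ob : C))); first exact: is_iso_lunit.
exact: hom_unit_unique.
Qed.

Lemma runit_lunit_middle_swap (X Y : C) :
  (runit X ⊗ₘ lunit Y) ∘ middle_swap X unit_ob unit_ob Y = runit X ⊗ₘ lunit Y.
Proof.
rewrite /middle_swap swap_unit tensm_id comp_idr assocK' tensm_id comp_idr.
by rewrite assocK comp_idr.
Qed.

Lemma proj_copy (X Y : C) :
  (proj1 X Y ⊗ₘ proj2 X Y) ∘ copy (X ⊗ Y) = idm (X ⊗ Y).
Proof.
rewrite copy_tens /proj1 /proj2 tensm_comp -compA.
rewrite (compA (_ ⊗ₘ _) (middle_swap _ _ _ _)) -middle_swap_nat 2!compA runit_lunit_middle_swap -!tensm_comp.
by rewrite copy_delr copy_dell tensm_id.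
Qed.

Lemma proj1_copy (X : C) : proj1 X X ∘ copy X = idm X.
Proof. exact: copy_delr. Qed.

Lemma deterministic_pair (W X Y : C) (i : hom W (X ⊗ Y)) :
  deterministic i -> i = ((proj1 X Y ∘ i) ⊗ₘ (proj2 X Y ∘ i)) ∘ copy W.
Proof. by move=> [_ ci]; rewrite tensm_comp -compA -ci compA proj_copy comp_idl. Qed.

End MarkovFacts.
Arguments proj1 {C} X Y.
Arguments proj2 {C} X Y.

Section PartializableFacts.
Variables (C : markov_category) (hC : partializable C).

Lemma det_mono_tensm (X Y X' Y' : C) (i : hom X Y) (j : hom X' Y') :
  det_mono i -> det_mono j -> det_mono (i ⊗ₘ j).
Proof.
move=> hi hj; split.
  by apply: deterministic_tensm; [case: hi | case: hj].
rewrite tensmE; apply: monic_comp; first exact: partializable_tens hi.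
have -> : idm X ⊗ₘ j = swap Y' X ∘ ((j ⊗ₘ idm X) ∘ swap X X').
  by rewrite compA swap_nat -compA swapK comp_idr.
apply: monic_comp; first exact/iso_monic/is_iso_swap.
apply: monic_comp; first exact: partializable_tens hj.
exact/iso_monic/is_iso_swap.
Qed.

Lemma factor_tensl (W A A' D : C) (u : hom D A) (a : hom W (A ⊗ A'))
    (c : hom W D) :
  det_mono u -> proj1 A A' ∘ a = u ∘ c -> exists w, (u ⊗ₘ idm A') ∘ w = a.
Proof.
move=> hu e.
have [[P [i [p hP]]] det] := partializable_pullback hC (proj1 A A') hu.
have [di _] := det _ _ _ hP.
have [/= ei U] := hP.
have [w [[iw _] _]] := U _ _ _ e.
exists ((p ⊗ₘ (proj2 A A' ∘ i)) ∘ copy P ∘ w).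
rewrite !compA -tensm_comp comp_idl -ei -deterministic_pair //.
Qed.

Lemma factor_tensr (W A A' D : C) (u : hom D A') (a : hom W (A ⊗ A'))
    (c : hom W D) :
  det_mono u -> proj2 A A' ∘ a = u ∘ c -> exists w, (idm A ⊗ₘ u) ∘ w = a.
Proof.
move=> hu e.
have [[P [i [p hP]]] det] := partializable_pullback hC (proj2 A A') hu.
have [di _] := det _ _ _ hP.
have [/= ei U] := hP.
have [w [[iw _] _]] := U _ _ _ e.
exists (((proj1 A A' ∘ i) ⊗ₘ p) ∘ copy P ∘ w).
rewrite !compA -tensm_comp comp_idl -ei -deterministic_pair //.
Qed.

Lemma tensm_pullback (A B Y D A' B' Y' D' : C)
    (f : hom A Y) (j : hom B Y) (u : hom D A) (v : hom D B)
    (f' : hom A' Y') (j' : hom B' Y') (u' : hom D' A') (v' : hom D' B') :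
  det_mono j -> det_mono j' ->
  is_pullback f j u v -> is_pullback f' j' u' v' ->
  is_pullback (f ⊗ₘ f') (j ⊗ₘ j') (u ⊗ₘ u') (v ⊗ₘ v').
Proof.
move=> hj hj' hP hP'.
have hu : det_mono u.
  by have [_ det] := partializable_pullback hC f hj; exact: det hP.
have hu' : det_mono u'.
  by have [_ det] := partializable_pullback hC f' hj'; exact: det hP'.
have [e U] := hP; have [e' U'] := hP'.
apply: mono_pullback; first by case: (det_mono_tensm hj hj').
- by case: (det_mono_tensm hu hu').
- by rewrite -!tensm_comp e e'.
move=> W a b eab.
have /U [c [[uc _] _]] : f ∘ (proj1 A A' ∘ a) = j ∘ (proj1 B B' ∘ b).
  by rewrite compA -(proj1_nat f f') -compA eab [LHS]compA proj1_nat -compA.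
have /U' [c' [[uc' _] _]] : f' ∘ (proj2 A A' ∘ a) = j' ∘ (proj2 B B' ∘ b).
  by rewrite compA -(proj2_nat f f') -compA eab [LHS]compA proj2_nat -compA.
have [w wa] := factor_tensl hu (esym uc).
have ew : proj2 D A' ∘ w = u' ∘ c'.
  by rewrite uc' -wa compA proj2_nat comp_idl.
have [w' w'w] := factor_tensr hu' ew.
by exists w'; rewrite tensmE -compA w'w.
Qed.

Lemma copy_pullback (X D : C) (i : hom D X) :
  det_mono i -> is_pullback (copy X) (i ⊗ₘ i) i (copy D).
Proof.
move=> hi; have [[_ ci] mi] := hi.
apply: mono_pullback => //; first by case: (det_mono_tensm hi hi).
move=> W a b e; exists (proj1 D D ∘ b).
by rewrite compA -(proj1_nat i i) -compA -e compA proj1_copy comp_idl.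
Qed.

End PartializableFacts.

Record span (C : cd_category) (X Y : C) := Span {
  span_dom : C;
  span_mono : hom span_dom X;
  span_map : hom span_dom Y;
  span_det_mono : det_mono span_mono }.

HB.instance Definition _ (C : cd_category) (X Y : C) :=
  Choice.copy (span X Y) {classic span X Y}.

Section SpanEquivalence.
Variables (C : cd_category) (X Y : C).

Definition span_eqv (s s' : span X Y) : Prop :=
  exists t : hom (span_dom s) (span_dom s'),
    is_iso t /\ span_mono s' ∘ t = span_mono s
             /\ span_map s' ∘ t = span_map s.

Definition span_eqvb : rel (span X Y) := fun s s' => `[< span_eqv s s' >].

Lemma span_eqvb_refl : reflexive span_eqvb.
Proof.
move=> s; apply/asboolP; exists (idm _); rewrite !comp_idr.
by split=> //; exists (idm _); rewrite comp_idl.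
Qed.

Lemma span_eqvb_trans : transitive span_eqvb.
Proof.
move=> s2 s1 s3 /asboolP [t [[t' [tK tK']] [t1 t2]]].
move=> /asboolP [r [[r' [rK rK']] [r1 r2]]].
apply/asboolP; exists (r ∘ t); rewrite !compA r1 r2 t1 t2; split=> //.
exists (t' ∘ r'); split.
  by rewrite -compA (compA r') rK comp_idl tK.
by rewrite -compA (compA t) tK' comp_idl rK'.
Qed.

Lemma span_eqvb_sym : symmetric span_eqvb.
Proof.
have imp s s' : span_eqvb s s' -> span_eqvb s' s.
  move=> /asboolP [t [[t' [tK tK']] [t1 t2]]]; apply/asboolP; exists t'.
  split; first by exists t.
  by rewrite -t1 -t2 -!compA tK' !comp_idr.
by move=> s s'; apply/idP/idP; apply: imp.
Qed.

Canonical span_equiv :=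
  EquivRel span_eqvb span_eqvb_refl span_eqvb_sym span_eqvb_trans.

Definition partial_hom := {eq_quot span_equiv}%qT.

Definition span_class (s : span X Y) : partial_hom := \pi_partial_hom%qT s.

Lemma span_classP (s s' : span X Y) :
  span_class s = span_class s' <-> span_eqv s s'.
Proof.
split=> [/eqmodP/asboolP // | h]; exact/eqmodP/asboolP.
Qed.

Lemma span_class_repr (F : partial_hom) : span_class (repr F) = F.
Proof. exact: reprK. Qed.

Lemma partial_homP (F : partial_hom) : exists s, F = span_class s.
Proof. by exists (repr F); rewrite span_class_repr. Qed.

Lemma span_class_eq (D : C) (i i' : hom D X) (f f' : hom D Y)
    (hi : det_mono i) (hi' : det_mono i') :
  i = i' -> f = f' -> span_class (Span f hi) = span_class (Span f' hi').
Proof.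
move=> ei ef; apply/span_classP; exists (idm D) => /=; rewrite !comp_idr.
by split=> //; exists (idm D); rewrite comp_idl.
Qed.

End SpanEquivalence.

Section Partial.
Variables (C : markov_category) (hC : partializable C).

Record chosen_pullback (X Y Z : C) (f : hom X Z) (j : hom Y Z) :=
  ChosenPullback {
    pb_ob : C;
    pb_fst : hom pb_ob X;
    pb_snd : hom pb_ob Y;
    pb_is_pullback : is_pullback f j pb_fst pb_snd;
    pb_det_mono : det_mono pb_fst }.

Lemma chosen_pullback_exists (X Y Z : C) (f : hom X Z) (j : hom Y Z) :
  det_mono j -> exists _ : chosen_pullback f j, True.
Proof.
move=> hj; have [[P [p [q hP]]] det] := partializable_pullback hC f hj.
by exists (ChosenPullback hP (det _ _ _ hP)).
Qed.

Definition choose_pullback (X Y Z : C) (f : hom X Z) (j : hom Y Z)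
    (hj : det_mono j) : chosen_pullback f j :=
  projT1 (cid (chosen_pullback_exists f hj)).

Definition span_id (X : C) : span X X := Span (idm X) (det_mono_idm X).

Definition span_comp (X Y Z : C) (t : span Y Z) (s : span X Y) : span X Z :=
  let P := choose_pullback (span_map s) (span_det_mono t) in
  Span (span_map t ∘ pb_snd P) (det_mono_comp (span_det_mono s) (pb_det_mono P)).

Definition span_tens (X Y X' Y' : C) (s : span X Y) (s' : span X' Y') :
    span (X ⊗ X') (Y ⊗ Y') :=
  Span (span_map s ⊗ₘ span_map s')
    (det_mono_tensm hC (span_det_mono s) (span_det_mono s')).

Definition partial_comp (X Y Z : C) (G : partial_hom Y Z)
    (F : partial_hom X Y) : partial_hom X Z :=
  span_class (span_comp (repr G) (repr F)).

Definition partial_tens (X Y X' Y' : C) (F : partial_hom X Y)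
    (F' : partial_hom X' Y') : partial_hom (X ⊗ X') (Y ⊗ Y') :=
  span_class (span_tens (repr F) (repr F')).

Definition partial_incl (X Y : C) (f : hom X Y) : partial_hom X Y :=
  span_class (Span f (det_mono_idm X)).

Lemma span_class_iso (X Y D D' : C) (i : hom D X) (f : hom D Y)
    (i' : hom D' X) (f' : hom D' Y) (hi : det_mono i) (hi' : det_mono i')
    (t : hom D D') :
  is_iso t -> i' ∘ t = i -> f' ∘ t = f ->
  span_class (Span f hi) = span_class (Span f' hi').
Proof. by move=> ht ei ef; apply/span_classP; exists t. Qed.

(* The composite does not depend on the chosen representatives and pullback. *)
Lemma partial_comp_class (X Y Z D : C) (t : span Y Z) (s : span X Y)
    (u : hom D (span_dom s)) (v : hom D (span_dom t))
    (h : det_mono (span_mono s ∘ u)) :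
  is_pullback (span_map s) (span_mono t) u v ->
  partial_comp (span_class t) (span_class s) = span_class (Span (span_map t ∘ v) h).
Proof.
rewrite /partial_comp => hP.
have /span_classP [a [[a' [aK aK']] [a1 a2]]] := span_class_repr (span_class s).
have /span_classP [b [[b' [bK bK']] [b1 b2]]] := span_class_repr (span_class t).
move: a a' aK aK' a1 a2 b b' bK bK' b1 b2.
move: (repr _) => s0; move: (repr _) => t0.
move=> a a' aK aK' a1 a2 b b' bK bK' b1 b2.
rewrite /span_comp; case: (choose_pullback _ _) => Q p q hQ hp /=.
have hQ' : is_pullback (span_map s) (span_mono t) (a ∘ p) (b ∘ q).
  have [e U] := hQ; split.
    by rewrite !compA a2 b1.
  move=> W x y exy.
  have /U [w [[w1 w2] Uw]] : span_map s0 ∘ (a' ∘ x) = span_mono t0 ∘ (b' ∘ y).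
    by rewrite -a2 -b1 -!compA !(compA _ a') !(compA _ b') aK' bK' !comp_idl.
  exists w; split.
    by rewrite -!compA w1 w2 !compA aK' bK' !comp_idl.
  move=> w' [w'1 w'2]; apply: Uw.
  by rewrite -w'1 -w'2 !compA aK bK !comp_idl.
have [r [hr [r1 r2]]] := pullback_unique hQ' hP.
apply: span_class_iso hr _ _; first by rewrite -compA r1 compA a1.
by rewrite -compA r2 compA b2.
Qed.

Lemma partial_tens_class (X Y X' Y' : C) (s : span X Y) (s' : span X' Y') :
  partial_tens (span_class s) (span_class s') = span_class (span_tens s s').
Proof.
rewrite /partial_tens; apply/span_classP.
have /span_classP [a [[a' [aK aK']] [a1 a2]]] := span_class_repr (span_class s).
have /span_classP [b [[b' [bK bK']] [b1 b2]]] := span_class_repr (span_class s').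
exists (a ⊗ₘ b) => /=; rewrite -!tensm_comp a1 a2 b1 b2; split=> //.
by exists (a' ⊗ₘ b'); rewrite -!tensm_comp aK bK aK' bK' !tensm_id.
Qed.

Lemma pullback_det_mono (X Y Z D : C) (f : hom X Z) (j : hom Y Z)
    (u : hom D X) (v : hom D Y) : det_mono j -> is_pullback f j u v -> det_mono u.
Proof. by move=> hj; have [_] := partializable_pullback hC f hj; apply. Qed.

Lemma partial_comp_incll (X Y Z : C) (g : hom Y Z) (s : span X Y) :
  partial_comp (partial_incl g) (span_class s) =
  span_class (Span (g ∘ span_map s) (span_det_mono s)).
Proof.
have hP := id_pullbackr (span_map s).
rewrite (@partial_comp_class _ _ _ _ (Span g (det_mono_idm Y)) s _ _ _ hP).
  by rewrite comp_idr; exact: span_det_mono.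
by move=> h; apply: span_class_eq => //=; rewrite comp_idr.
Qed.

Lemma partial_comp_inclr (X Y Z D : C) (t : span Y Z) (f : hom X Y)
    (u : hom D X) (v : hom D (span_dom t)) (hu : det_mono u) :
  is_pullback f (span_mono t) u v ->
  partial_comp (span_class t) (partial_incl f) =
  span_class (Span (span_map t ∘ v) hu).
Proof.
move=> hP.
rewrite (@partial_comp_class _ _ _ _ t (Span f (det_mono_idm X)) _ _ _ hP).
  by rewrite comp_idl.
by move=> h; apply: span_class_eq => //=; rewrite comp_idl.
Qed.

Lemma partial_incl_comp (X Y Z : C) (g : hom Y Z) (f : hom X Y) :
  partial_comp (partial_incl g) (partial_incl f) = partial_incl (g ∘ f).
Proof. by rewrite partial_comp_incll. Qed.

Lemma partial_incl_tens (X Y X' Y' : C) (f : hom X Y) (g : hom X' Y') :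
  partial_tens (partial_incl f) (partial_incl g) = partial_incl (f ⊗ₘ g).
Proof.
by rewrite partial_tens_class; apply: span_class_eq => //=; exact: tensm_id.
Qed.

Lemma partial_comp_idl (X Y : C) (F : partial_hom X Y) :
  partial_comp (partial_incl (idm Y)) F = F.
Proof.
have [s ->] := partial_homP F; rewrite partial_comp_incll.
by case: s => D i f hi; apply: span_class_eq => //=; rewrite comp_idl.
Qed.

Lemma partial_comp_idr (X Y : C) (F : partial_hom X Y) :
  partial_comp F (partial_incl (idm X)) = F.
Proof.
have [s ->] := partial_homP F.
rewrite (partial_comp_inclr (span_det_mono s) (id_pullbackl _)).
by case: s => D i f hi; apply: span_class_eq => //=; rewrite comp_idr.
Qed.

Lemma partial_compA (X Y Z W : C) (H : partial_hom Z W) (G : partial_hom Y Z)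
    (F : partial_hom X Y) :
  partial_comp H (partial_comp G F) = partial_comp (partial_comp H G) F.
Proof.
have [[A i f hi] ->] := partial_homP F.
have [[B j g hj] ->] := partial_homP G.
have [[E k h hk] ->] := partial_homP H.
have [P p1 p2 hP dP] := choose_pullback f hj.
have [Q q1 q2 hQ dQ] := choose_pullback g hk.
have [S s1 s2 hS dS] := choose_pullback p2 dQ.
have [hS1 hS2] := pullback_paste hP hQ hS.
have d1 := det_mono_comp hi dP.
have d2 := det_mono_comp hj dQ.
rewrite (@partial_comp_class _ _ _ _ (Span g hj) (Span f hi) p1 p2 d1 hP).
rewrite (@partial_comp_class _ _ _ _ (Span h hk) (Span g hj) q1 q2 d2 hQ).
have d3 := det_mono_comp d1 dS.
have d4 := det_mono_comp hi (det_mono_comp dP dS).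
rewrite (@partial_comp_class _ _ _ _ (Span h hk) (Span _ d1) s1 _ d3 hS2).
rewrite (@partial_comp_class _ _ _ _ (Span _ d2) (Span f hi) _ s2 d4 hS1).
by apply: span_class_eq; rewrite /= compA.
Qed.

Definition partial_cat : category :=
  Category partial_comp_idl partial_comp_idr partial_compA.

Lemma partial_tens_id (X Y : C) :
  partial_tens (partial_incl (idm X)) (partial_incl (idm Y)) =
  partial_incl (idm (X ⊗ Y)).
Proof. by rewrite partial_incl_tens tensm_id. Qed.

Lemma partial_tens_comp (X Y Z X' Y' Z' : C)
    (G : partial_hom Y Z) (F : partial_hom X Y)
    (G' : partial_hom Y' Z') (F' : partial_hom X' Y') :
  partial_tens (partial_comp G F) (partial_comp G' F') =
  partial_comp (partial_tens G G') (partial_tens F F').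
Proof.
have [[A i f hi] ->] := partial_homP F.
have [[B j g hj] ->] := partial_homP G.
have [[A' i' f' hi'] ->] := partial_homP F'.
have [[B' j' g' hj'] ->] := partial_homP G'.
have [P p q hP dP] := choose_pullback f hj.
have [P' p' q' hP' dP'] := choose_pullback f' hj'.
have d := det_mono_comp hi dP.
have d' := det_mono_comp hi' dP'.
rewrite (@partial_comp_class _ _ _ _ (Span g hj) (Span f hi) p q d hP).
rewrite (@partial_comp_class _ _ _ _ (Span g' hj') (Span f' hi') p' q' d' hP').
rewrite !partial_tens_class.
have hPP := tensm_pullback hC hj hj' hP hP'.
rewrite (@partial_comp_class _ _ _ _ (span_tens (Span g hj) (Span g' hj'))
  (span_tens (Span f hi) (Span f' hi')) _ _ _ hPP).
  exact: (det_mono_comp (det_mono_tensm hC hi hi') (det_mono_tensm hC dP dP')).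
by move=> h; apply: span_class_eq; rewrite /= tensm_comp.
Qed.

Lemma partial_iso_nat (X X' Y Y' D D' : C) (phi : hom X X') (psi : hom Y Y')
    (i : hom D X) (f : hom D Y) (hi : det_mono i)
    (i' : hom D' X') (f' : hom D' Y') (hi' : det_mono i') (theta : hom D D') :
  is_iso phi -> is_iso theta ->
  phi ∘ i = i' ∘ theta -> psi ∘ f = f' ∘ theta ->
  partial_comp (partial_incl psi) (span_class (Span f hi)) =
  partial_comp (span_class (Span f' hi')) (partial_incl phi).
Proof.
move=> hphi htheta e1 e2; have hP := iso_pullback hphi htheta e1.
rewrite partial_comp_incll.
rewrite (@partial_comp_inclr _ _ _ _ (Span f' hi') _ _ _ hi hP).
exact: span_class_eq.
Qed.

Lemma partial_assoc_nat (X Y Z X' Y' Z' : C) (F : partial_hom X X')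
    (G : partial_hom Y Y') (H : partial_hom Z Z') :
  partial_comp (partial_incl (assoc X' Y' Z')) (partial_tens (partial_tens F G) H) =
  partial_comp (partial_tens F (partial_tens G H)) (partial_incl (assoc X Y Z)).
Proof.
have [[D i f hi] ->] := partial_homP F; have [[E j g hj] ->] := partial_homP G.
have [[K k h hk] ->] := partial_homP H; rewrite !partial_tens_class.
apply: partial_iso_nat (is_iso_assoc _ _ _) (is_iso_assoc _ _ _) _ _;
  exact: assoc_nat.
Qed.

Lemma partial_lunit_nat (X Y : C) (F : partial_hom X Y) :
  partial_comp (partial_incl (lunit Y))
    (partial_tens (partial_incl (idm unit_ob)) F) =
  partial_comp F (partial_incl (lunit X)).
Proof.
have [[D i f hi] ->] := partial_homP F; rewrite partial_tens_class.
apply: partial_iso_nat (is_iso_lunit _) (is_iso_lunit _) _ _;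
  exact: lunit_nat.
Qed.

Lemma partial_runit_nat (X Y : C) (F : partial_hom X Y) :
  partial_comp (partial_incl (runit Y))
    (partial_tens F (partial_incl (idm unit_ob))) =
  partial_comp F (partial_incl (runit X)).
Proof.
have [[D i f hi] ->] := partial_homP F; rewrite partial_tens_class.
apply: partial_iso_nat (is_iso_runit _) (is_iso_runit _) _ _;
  exact: runit_nat.
Qed.

Lemma partial_swap_nat (X Y X' Y' : C) (F : partial_hom X X')
    (G : partial_hom Y Y') :
  partial_comp (partial_incl (swap X' Y')) (partial_tens F G) =
  partial_comp (partial_tens G F) (partial_incl (swap X Y)).
Proof.
have [[D i f hi] ->] := partial_homP F; have [[E j g hj] ->] := partial_homP G.
rewrite !partial_tens_class.
apply: partial_iso_nat (is_iso_swap _ _) (is_iso_swap _ _) _ _;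
  exact: swap_nat.
Qed.

Local Notation pincl_simp := (partial_incl_tens, partial_incl_comp).

Definition partial_smc : sym_mon_category.
Proof.
refine (@SymMonCategory partial_cat (@tens C) (@unit_ob C) partial_tens
  (fun X Y Z => partial_incl (assoc X Y Z))
  (fun X Y Z => partial_incl (assoc' X Y Z))
  (fun X => partial_incl (lunit X)) (fun X => partial_incl (lunit' X))
  (fun X => partial_incl (runit X)) (fun X => partial_incl (runit' X))
  (fun X Y => partial_incl (swap X Y))
  partial_tens_id partial_tens_comp _ _ _ _ _ _ _
  partial_assoc_nat partial_lunit_nat partial_runit_nat partial_swap_nat
  _ _ _); abstract (move=> *; rewrite /= ?pincl_simp;
    by rewrite ?(assocK, assocK', lunitK, lunitK', runitK, runitK', swapK,
      pentagon, triangle, hexagon)).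
Defined.

Definition partial_cd : cd_category.
Proof.
refine (@CDCategory partial_smc (fun X => partial_incl (copy X))
  (fun X => partial_incl (del X)) _ _ _ _ _ _ _ _);
  abstract (move=> *; rewrite /middle_swap /= ?pincl_simp;
    by rewrite ?(copyA, copyC, copy_dell, copy_delr, copy_tens, del_tens,
      copy_unit, del_unit)).
Defined.

Lemma partial_quasi_total (X Y : C) (F : partial_hom X Y) :
  @quasi_total partial_cd X Y F.
Proof.
rewrite /quasi_total /=; have [[D i f hi] ->] := partial_homP F.
rewrite partial_comp_incll partial_tens_class -partial_compA.
have hP := copy_pullback hC hi.
rewrite (@partial_comp_inclr _ _ _ _
  (span_tens (Span f hi) (Span (del Y ∘ f) hi)) _ _ _ hi hP) /=.
rewrite partial_comp_incll; apply: span_class_eq => //=.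
by rewrite compA; exact: (total_quasi_total (markov_total f)).
Qed.

Definition Partial : quasi_markov_category :=
  @QuasiMarkovCategory partial_cd partial_quasi_total.

End Partial.

(* Main.v *)
Require Import Defs.
From mathcomp Require Import ssreflect.

Set Implicit Arguments.
Unset Strict Implicit.
Unset Printing Implicit Defensive.
Local Open Scope cat_scope.

(** Positivity of the category of partial maps reduces to positivity of C
    because every partial map involved is defined on one and the same
    subobject, so that an equation of partial maps becomes an equation in C.

    Let u = (A, i, f) and v = (B, j, g), and let P, with p : P -> A and
    q : P -> B, be the pullback of f and j, so that v ∘ u = (P, i ∘ p, g ∘ q).
    Copying v ∘ u keeps the domain P, and a span is determined by its map once
    its monomorphism is fixed ([span_class_map_inj]); hence v ∘ u is copyable
    exactly when g ∘ q is copyable in C.  Both sides of the positivity equation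
    also have domain P: for u ⊗ (v ∘ u) after copying, a point of X where both
    i and i ∘ p are defined is a point of P ([copy_pullback_restr]); for the
    other side, copying the value f and then asking v to be defined on the
    second copy cuts A down to P ([copy_comp_pullback]).  Since
    f ∘ p = j ∘ q, the two maps on P are
<<
      ((j ∘ q) ⊗ (g ∘ q)) ∘ copy P   and   (j ⊗ g) ∘ copy B ∘ q,
>>
    and these agree by positivity of C for q followed by g. *)

Section Markov.
Variable C : markov_category.

Lemma proj2_copy (X : C) : proj2 X X ∘ copy X = idm X.
Proof. exact: copy_dell. Qed.

(** Equivalent spans with the same monomorphism are related by an automorphism
    over it, which can only be the identity. *)
Lemma span_class_map_inj (X Y D : C) (i : hom D X) (f g : hom D Y)
    (hi hi' : det_mono i) :
  span_class (Span f hi) = span_class (Span g hi') -> f = g.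
Proof.
move=> /span_classP [t [_ /= [it <-]]].
have -> : t = idm D by have [_ mi] := hi; apply: mi; rewrite it comp_idr.
exact: comp_idr.
Qed.

Hypothesis hC : partializable C.

(** The intersection of a subobject with a smaller one is the smaller one, in
    the form taken by copying a point and restricting each copy. *)
Lemma copy_pullback_restr (X D P : C) (i : hom D X) (p : hom P D) :
  det_mono i -> det_mono p ->
  is_pullback (copy X) (i ⊗ₘ (i ∘ p)) (i ∘ p) ((p ⊗ₘ idm P) ∘ copy P).
Proof.
move=> hi hp; have hip := det_mono_comp hi hp; have [[_ cip] mip] := hip.
apply: mono_pullback => //; first by case: (det_mono_tensm hC hi hip).
  by rewrite cip compA -tensm_comp comp_idr.
move=> W a b e; exists (proj2 D P ∘ b).
by rewrite compA -(proj2_nat i) -compA -e compA proj2_copy comp_idl.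
Qed.

(** Only the second copy is tested for membership in [B], yet the lift into
    [Y ⊗ B] exists with the first copy equal to the image of the second under
    [j], because [j] is deterministic. *)
Lemma copy_comp_pullback (A B Y P : C) (f : hom A Y) (j : hom B Y)
    (p : hom P A) (q : hom P B) :
  det_mono j -> is_pullback f j p q ->
  is_pullback (copy Y ∘ f) (idm Y ⊗ₘ j) p ((j ⊗ₘ idm B) ∘ copy B ∘ q).
Proof.
move=> hj hP; have [e U] := hP; have [[_ cj] _] := hj.
apply: mono_pullback.
- by case: (det_mono_tensm hC (det_mono_idm Y) hj).
- by case: (pullback_det_mono hC hj hP).
- by rewrite -compA e !compA cj -tensm_comp comp_idl comp_idr.
move=> W a b eab.
have /U [w [[pw _] _]] : f ∘ a = j ∘ (proj2 Y B ∘ b).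
  by rewrite compA -(proj2_nat (idm Y)) -compA -eab !compA proj2_copy comp_idl.
by exists w.
Qed.

(** Both sides of the copyability equation are spans with monomorphism [i]: for
    the tensor square after copying this is [copy_pullback].  The equation can
    therefore be read off on the maps. *)
Lemma copyable_span_class (X Y D : C) (i : hom D X) (f : hom D Y)
    (hi : det_mono i) :
  @copyable (Partial hC) X Y (span_class (Span f hi)) -> copyable f.
Proof.
rewrite /copyable /= partial_comp_incll partial_tens_class.
rewrite (partial_comp_inclr (t := span_tens hC (Span f hi) (Span f hi)) hC hi
  (copy_pullback hC hi)) /=.
exact: span_class_map_inj.
Qed.

End Markov.

Theorem proposition1p9 (C : markov_category) (hC : partializable C) :
  positive (Partial hC).
Proof.
move=> X Y Z u v.
have [[A i f hi] ->] := partial_homP u.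
have [[B j g hj] ->] := partial_homP v => {u v}.
have [P p q hP hp] := choose_pullback hC f hj.
have hip := det_mono_comp hi hp.
have -> : @comp (Partial hC) X Y Z (span_class (Span g hj))
    (span_class (Span f hi)) = span_class (Span (g ∘ q) hip).
  exact: (@partial_comp_class _ hC _ _ _ _ (Span g hj) (Span f hi) p q hip hP).
move=> /copyable_span_class /(partializable_positive hC) pos.
rewrite /= -partial_compA partial_comp_incll !partial_tens_class.
rewrite (partial_comp_inclr (t := span_tens hC (Span f hi) (Span _ hip)) hC hip
  (copy_pullback_restr hC hi hp)) /=.
rewrite (@partial_comp_class _ hC _ _ _ _
  (span_tens hC (Span (@idm C Y) (@det_mono_idm C Y)) (Span g hj)) (Span _ hi)
  p _ hip (copy_comp_pullback hC hj hP)).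
apply: span_class_eq => //=.
have [e _] := hP.
rewrite compA -tensm_comp comp_idr e -[g ∘ q in LHS]comp_idl tensm_comp.
by rewrite -compA pos !compA -!tensm_comp !comp_idl !comp_idr.
Qed.
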